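(* Let $\rho>0$ and let $Q\in\mathbb R^{n_{\mathrm f}\times n_{\mathrm f}}$ be symmetric positive definite. The function $g:\mathbb R^m\to\mathbb R$ defined by $$g(\lambda)=-\tfrac12\lambda^\top A_{\mathrm f}Q^{-1}A_{\mathrm f}^\top\lambda+\lambda^\top(A_{\mathrm f}Q^{-1}w_{\mathrm f}+b)-\tfrac12w_{\mathrm f}^\top Q^{-1}w_{\mathrm f}-\tfrac\rho2\sum_{j=1}^{m_{\mathrm{sos}}}\Bigl\|\mathcal P_{\mathbb S_+^{h_j}}\bigl(\tfrac1\rho({A_{\mathrm{sos}}^{(j)}}^\top\lambda-w_{\mathrm{sos}}^{(j)})\bigr)\Bigr\|_2^2$$ is concave and differentiable on $\mathbb R^m$.
   Context: Data: integers $m,n_{\mathrm f},m_{\mathrm{sos}},h_j\ge1$; $A_{\mathrm f}\in\mathbb R^{m\times n_{\mathrm f}}$, $w_{\mathrm f}\in\mathbb R^{n_{\mathrm f}}$, $b\in\mathbb R^m$, and for $j=1,\dots,m_{\mathrm{sos}}$, $A_{\mathrm{sos}}^{(j)}\in\mathbb R^{m\times h_j(h_j+1)/2}$, $w_{\mathrm{sos}}^{(j)}\in\mathbb R^{h_j(h_j+1)/2}$. Vectorization: for a symmetric $h\times h$ matrix $X$, $\operatorname{svec}(X)\in\mathbb R^{h(h+1)/2}$ stacks its upper triangular entries with off-diagonal entries multiplied by $\sqrt2$ (so $\|X\|_{\mathrm F}=\|\operatorname{svec}(X)\|_2$), and $\operatorname{smat}$ is its inverse. A vector $\zeta\in\mathbb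 R^{h(h+1)/2}$ is identified with $\operatorname{smat}(\zeta)$; $\mathcal P_{\mathbb S_+^h}(\zeta)$ denotes the Euclidean projection of $\zeta$ onto $\{\zeta:\operatorname{smat}(\zeta)\text{ positive semidefinite}\}$, i.e. $\operatorname{svec}$ of the Frobenius projection of $\operatorname{smat}(\zeta)$ onto the positive semidefinite cone. *)

(* Defs.v *)
From HB Require Import structures.
From mathcomp Require Import all_boot all_order all_algebra.
From mathcomp Require Import all_classical all_reals all_analysis.

Set Implicit Arguments.
Unset Strict Implicit.
Unset Printing Implicit Defensive.

Import Order.TTheory GRing.Theory Num.Theory.
Import numFieldNormedType.Exports.

Local Open Scope classical_set_scope.
Local Open Scope ring_scope.
Local Open Scope convex_scope.

(* Mirror image of the library's convex_function. *)
Definition concave_function (R : numFieldType) (E : lmodType R)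
    (E' := convex_lmodType E) (D : set E') (f : E' -> R^o) :=
  forall t : {i01 R},
    {in D &, forall x y : E', (f x <| t |> f y <= f (x <| t |> y))%R}.

Section Matrices.
Context {R : realType}.

(* The norm `|x| of the library on matrices is the sup norm. *)
Definition norm2 n (x : 'cV[R]_n) : R := Num.sqrt (\sum_i x i 0 ^+ 2).

Definition posdefmx n (X : 'M[R]_n) : Prop :=
  X \is symmetricmx /\
  forall v : 'cV[R]_n, v != 0 -> 0 < (v^T *m X *m v) 0 0.

Definition possemidefmx n (X : 'M[R]_n) : Prop :=
  X \is symmetricmx /\
  forall v : 'cV[R]_n, 0 <= (v^T *m X *m v) 0 0.

Definition is_projection n (C : set 'cV[R]_n) (x p : 'cV[R]_n) : Prop :=
  C p /\ forall y, C y -> norm2 (x - p) <= norm2 (x - y).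

(* A nearest point of C (unique when C is nonempty, closed and convex), and the
   junk value 0 when there is none. *)
Definition projection n (C : set 'cV[R]_n) (x : 'cV[R]_n) : 'cV[R]_n :=
  xget 0 [set p | is_projection C x p].

End Matrices.

Section Vectorization.

Definition svec_dim (h : nat) : nat := (h * h.+1)./2.

Lemma svec_dimS h : svec_dim h.+1 = (svec_dim h + h.+1)%N.
Proof.
rewrite /svec_dim (_ : h.+1 * h.+2 = h * h.+1 + (h.+1).*2)%N.
  by rewrite halfD doubleK odd_double andbF.
by rewrite -muln2 [(h * _)%N]mulnC -mulnDr addn2.
Qed.

Lemma leq_svec_dim h k : (h <= k)%N -> (svec_dim h <= svec_dim k)%N.
Proof. by move=> hk; rewrite /svec_dim half_leq// leq_mul. Qed.

Lemma svec_idx_subproof h (i j : 'I_h) :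
  (svec_dim (maxn i j) + minn i j < svec_dim h)%N.
Proof.
apply: (@leq_trans (svec_dim (maxn i j).+1)).
  by rewrite svec_dimS ltn_add2l ltnS (leq_trans (geq_minl _ _))// leq_maxl.
by apply: leq_svec_dim; rewrite gtn_max !ltn_ord.
Qed.

(* Position of the entry (i, j), equivalently (j, i), of a symmetric matrix
   when its upper triangle is stacked column by column. *)
Definition svec_idx h (i j : 'I_h) : 'I_(svec_dim h) :=
  Ordinal (svec_idx_subproof i j).

Lemma svec_idxC h (i j : 'I_h) : svec_idx i j = svec_idx j i.
Proof. by apply: val_inj; rewrite /= maxnC minnC. Qed.

Lemma svec_idx_inj h (i j i' j' : 'I_h) : (i <= j)%N -> (i' <= j')%N ->
  svec_idx i j = svec_idx i' j' -> i = i' /\ j = j'.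
Proof.
move=> ij ij' /(congr1 val) /=.
rewrite (maxn_idPr ij) (minn_idPl ij) (maxn_idPr ij') (minn_idPl ij') => e.
have lem (a b c d : nat) : (a <= b)%N -> (b < d)%N ->
    (svec_dim b + a < svec_dim d + c)%N.
  move=> ab bd; rewrite (leq_trans _ (leq_addr _ _))//.
  rewrite (leq_trans _ (leq_svec_dim bd))//.
  by rewrite svec_dimS ltn_add2l ltnS.
have [jj|jj|jj] := ltngtP (j : nat) j'.
- by have := lem i j i' j' ij jj; rewrite e ltnn.
- by have := lem i' j' i j ij' jj; rewrite e ltnn.
- by move: e; rewrite jj => /addnI ii; split; apply: val_inj.
Qed.

Lemma svec_idx_surj h (k : 'I_(svec_dim h)) :
  exists i j : 'I_h, (i <= j)%N /\ svec_idx i j = k.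
Proof.
suff H : exists i j : nat,
    [/\ (i <= j)%N, (j < h)%N & (svec_dim j + i = k)%N].
  have [i [j [ij jh e]]] := H.
  exists (Ordinal (leq_ltn_trans ij jh)), (Ordinal jh); split => //.
  by apply: val_inj; rewrite /= (maxn_idPr ij) (minn_idPl ij).
case: k => k /=; elim: h => [|h IH] //.
rewrite svec_dimS => kh; have [/IH [i [j [ij jh e]]]|hk] := ltnP k (svec_dim h).
  by exists i, j; split => //; apply: ltnW.
exists (k - svec_dim h)%N, h; split => //; last by rewrite subnKC.
by rewrite leq_subLR -ltnS -addnS.
Qed.

Context {R : realType}.

Definition svec h (X : 'M[R]_h) : 'cV[R]_(svec_dim h) :=
  \sum_(i < h) \sum_(j < h | (i <= j)%N)
    ((if i == j then X i j else Num.sqrt 2 * X i j)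
       *: delta_mx (svec_idx i j) 0).

Definition smat h (z : 'cV[R]_(svec_dim h)) : 'M[R]_h :=
  \matrix_(i, j) (if i == j then z (svec_idx i j) 0
                  else z (svec_idx i j) 0 / Num.sqrt 2).

Lemma svecE h (X : 'M[R]_h) (i j : 'I_h) : (i <= j)%N ->
  svec X (svec_idx i j) 0 = if i == j then X i j else Num.sqrt 2 * X i j.
Proof.
move=> ij; rewrite /svec summxE (bigD1 i)//= summxE (bigD1 j)//=.
rewrite !mxE !eqxx mulr1 big1 ?addr0 => [|j' /andP[ij' jj]]; last first.
  rewrite !mxE; case: (svec_idx i j =P _) => [/(svec_idx_inj ij ij')[_ e]|_]; last by rewrite mulr0.
  by rewrite e eqxx in jj.
rewrite big1 ?addr0// => i' ii; rewrite summxE big1// => j' ij'.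
rewrite !mxE; case: (svec_idx i j =P _) => [/(svec_idx_inj ij ij')[e _]|_]; last by rewrite mulr0.
by rewrite e eqxx in ii.
Qed.

Lemma smat_sym h (z : 'cV[R]_(svec_dim h)) : smat z \is symmetricmx.
Proof.
apply/eqP/matrixP => i j; rewrite expr0 scale1r !mxE /=.
by rewrite eq_sym svec_idxC.
Qed.

Lemma smatK h : cancel (@smat h) (@svec h).
Proof.
move=> z; apply/colP => k; have [i [j [ij <-]]] := svec_idx_surj k.
by rewrite svecE// mxE; case: eqP => // _; rewrite mulrC divfK// gt_eqF// sqrtr_gt0.
Qed.

Lemma svecK h (X : 'M[R]_h) : X \is symmetricmx -> smat (svec X) = X.
Proof.
move=> /eqP; rewrite expr0 scale1r => symX.
have {symX} symX (i j : 'I_h) : X i j = X j i by rewrite {1}symX !mxE.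
have s2 : Num.sqrt 2 != 0 :> R by rewrite gt_eqF// sqrtr_gt0.
apply/matrixP => i j; rewrite mxE.
have [ij|/ltnW ij] := leqP i j.
  by rewrite svecE//; case: eqP => // _; rewrite mulrC mulKf.
rewrite svec_idxC svecE// eq_sym symX.
by case: eqP => // _; rewrite mulrC mulKf.
Qed.

Lemma sum_svec h (F : 'I_(svec_dim h) -> R) :
  \sum_k F k = \sum_(i < h) \sum_(j < h | (i <= j)%N) F (svec_idx i j).
Proof.
pose P (k : 'I_(svec_dim h)) (p : 'I_h * 'I_h) :=
  (p.1 <= p.2)%N && (svec_idx p.1 p.2 == k).
have exP k : exists p, P k p.
  by have [i [j [ij <-]]] := svec_idx_surj k; exists (i, j); rewrite /P ij/=.
pose g k := xchoose (exP k).
have gP k : ((g k).1 <= (g k).2)%N /\ svec_idx (g k).1 (g k).2 = k.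
  by have /andP[? /eqP] := xchooseP (exP k).
rewrite (pair_big_dep predT (fun i j : 'I_h => (i <= j)%N)
  (fun i j => F (svec_idx i j))) /=.
rewrite (reindex_onto (fun p : 'I_h * 'I_h => svec_idx p.1 p.2) g) /=; last first.
  by move=> k _; have [] := gP k.
apply: eq_bigl => -[i j] /=; have [le e] := gP (svec_idx i j).
apply/eqP/idP => [ge|ij]; first by rewrite ge in le.
have [] := svec_idx_inj le ij e.
by case: (g _) => /= ? ? -> ->.
Qed.

Lemma norm2_svec h (X : 'M[R]_h) : X \is symmetricmx ->
  norm2 (svec X) = Num.sqrt (\sum_i \sum_j X i j ^+ 2).
Proof.
move=> /eqP; rewrite expr0 scale1r => symX.
have {}symX (i j : 'I_h) : X i j = X j i by rewrite {1}symX !mxE.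
congr Num.sqrt; rewrite sum_svec.
have split_svec (i j : 'I_h) : (i <= j)%N -> svec X (svec_idx i j) 0 ^+ 2 =
    X i j ^+ 2 + (if (i < j)%N then X i j ^+ 2 else 0).
  move=> ij; rewrite svecE//; case: eqP => [->|/eqP ij'].
    by rewrite ltnn addr0.
  rewrite ltn_neqAle ij (_ : nat_of_ord i != j)//=.
  by rewrite exprMn sqr_sqrtr// mulr_natl mulr2n.
under eq_bigr => i _ do under eq_bigr => j ij do rewrite split_svec//.
under eq_bigr => i _ do rewrite big_split /=.
rewrite big_split /=.
have -> : \sum_(i < h) \sum_(j < h | (i <= j)%N)
      (if (i < j)%N then X i j ^+ 2 else 0) =
    \sum_(i < h) \sum_(j < h) (if (j < i)%N then X i j ^+ 2 else 0).
  rewrite [RHS]exchange_big /=; apply: eq_bigr => i _.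
  rewrite big_mkcond /=; apply: eq_bigr => j _; rewrite symX.
  by case: (ltngtP i j).
rewrite -big_split /=; apply: eq_bigr => i _.
rewrite big_mkcond -big_split /=; apply: eq_bigr => j _.
by case: leqP => _; rewrite ?addr0 ?add0r.
Qed.

Definition psd_cone h : set 'cV[R]_(svec_dim h) :=
  [set z | possemidefmx (smat z)].

Definition proj_psd h : 'cV[R]_(svec_dim h) -> 'cV[R]_(svec_dim h) :=
  projection (@psd_cone h).

End Vectorization.

Definition dual_fun (R : realType) (m nf msos : nat) (h : 'I_msos -> nat)
    (Af : 'M[R]_(m, nf)) (wf : 'cV[R]_nf) (b : 'cV[R]_m)
    (Asos : forall j, 'M[R]_(m, svec_dim (h j)))
    (wsos : forall j, 'cV[R]_(svec_dim (h j)))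
    (rho : R) (Q : 'M[R]_nf) (lambda : 'cV[R]_m) : R :=
  - (2^-1 * (lambda^T *m Af *m invmx Q *m Af^T *m lambda) 0 0)
  + (lambda^T *m (Af *m invmx Q *m wf + b)) 0 0
  - 2^-1 * (wf^T *m invmx Q *m wf) 0 0
  - rho / 2 * \sum_(j < msos)
      norm2 (proj_psd (rho^-1 *: ((Asos j)^T *m lambda - wsos j))) ^+ 2.

(* Main.v *)
Require Import Defs.
From mathcomp Require Import all_boot all_order all_algebra.
From mathcomp Require Import all_classical all_reals all_analysis.
From mathcomp Require Import ring lra.
Import numFieldNormedType.Exports.
Local Open Scope classical_set_scope.
Local Open Scope ring_scope.

Set Implicit Arguments.
Unset Strict Implicit.
Unset Printing Implicit Defensive.

Import Order.TTheory GRing.Theory Num.Theory.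

(** The dual function g is concave and differentiable because, around every
    point, -g lies between an affine function touching it there and that same
    affine function plus a quadratic form in the displacement
    ([quad_supported]).  The lower bound at every point gives convexity of -g
    ([quad_supported_convex]); the two bounds together squeeze the remainder
    of the affine approximation to second order, which gives differentiability
    ([quad_supported_differentiable]).

    The property is stable under sums, nonnegative scalings and affine changes
    of variable.  Affine functions and nonnegative quadratic forms have it (the
    form of the inverse of Q is nonnegative, [invmx_form_ge0]), so only
    the function x |-> |p(x)|^2 remains, where p is the projection onto the
    positive semidefinite cone.

    This function is treated for any closed convex cone C.  The projection
    exists by compactness, and first-order optimality along rays of C gives
    <x - p(x), y> <= 0 for y in C ([projection_polar]) together with
    <x - p(x), p(x)> = 0 ([projection_orth]): Moreau's decomposition.
    Consequently |p(x)|^2 / 2 is the maximum over y in C of <x, y> - |y|^2 / 2,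
    attained at y = p(x), and also the minimum over q in the polar cone of
    |x - q|^2 / 2, attained at q = x - p(x).  Keeping p(x), respectively
    x - p(x), as a competitor at the point x + d yields
      2 <p(x), d> <= |p(x + d)|^2 - |p(x)|^2 <= 2 <p(x), d> + |d|^2,
    so the gradient of |p|^2 / 2 at x is p(x). *)

(** * Euclidean inner product of column vectors *)

Section InnerProduct.
Context {R : realType}.

Definition dot n (u v : 'cV[R]_n) : R := (u^T *m v) 0 0.

Lemma dotE n (u v : 'cV[R]_n) : dot u v = \sum_i u i 0 * v i 0.
Proof. by rewrite /dot mxE; apply: eq_bigr => i _; rewrite mxE. Qed.

Lemma dotC n (u v : 'cV[R]_n) : dot u v = dot v u.
Proof. by rewrite !dotE; apply: eq_bigr => i _; rewrite mulrC. Qed.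

Lemma dotDr n (u v w : 'cV[R]_n) : dot u (v + w) = dot u v + dot u w.
Proof. by rewrite /dot mulmxDr mxE. Qed.

Lemma dotZr n a (u v : 'cV[R]_n) : dot u (a *: v) = a * dot u v.
Proof. by rewrite /dot -scalemxAr mxE. Qed.

Lemma dotNr n (u v : 'cV[R]_n) : dot u (- v) = - dot u v.
Proof. by rewrite /dot mulmxN mxE. Qed.

Lemma dotDl n (u v w : 'cV[R]_n) : dot (v + w) u = dot v u + dot w u.
Proof. by rewrite dotC dotDr !(dotC u). Qed.

Lemma dotZl n a (u v : 'cV[R]_n) : dot (a *: v) u = a * dot v u.
Proof. by rewrite dotC dotZr (dotC u). Qed.

Lemma dotNl n (u v : 'cV[R]_n) : dot (- v) u = - dot v u.
Proof. by rewrite dotC dotNr (dotC u). Qed.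

Definition dot_linE := (dotDl, dotDr, dotNl, dotNr, dotZl, dotZr).

Lemma dot_mulmxr n p (A : 'M[R]_(n, p)) u v : dot u (A *m v) = dot (A^T *m u) v.
Proof. by rewrite /dot trmx_mul trmxK mulmxA. Qed.

Lemma dot_mulmxl n p (A : 'M[R]_(n, p)) u v : dot (A *m u) v = dot u (A^T *m v).
Proof. by rewrite dotC dot_mulmxr dotC. Qed.

Lemma dot_ge0 n (u : 'cV[R]_n) : 0 <= dot u u.
Proof. by rewrite dotE sumr_ge0// => i _; rewrite -expr2 sqr_ge0. Qed.

Lemma norm2_sqr n (u : 'cV[R]_n) : norm2 u ^+ 2 = dot u u.
Proof.
rewrite sqr_sqrtr; first by rewrite dotE; apply: eq_bigr => i _; rewrite expr2.
by apply: sumr_ge0 => i _; rewrite sqr_ge0.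
Qed.

Lemma ler_norm2 n (u v : 'cV[R]_n) : (norm2 u <= norm2 v) = (dot u u <= dot v v).
Proof. by rewrite -!norm2_sqr ler_sqr// nnegrE sqrtr_ge0. Qed.

Lemma normr_coord_le n (u : 'cV[R]_n) i : `|u i 0| <= norm2 u.
Proof.
rewrite -sqrtr_sqr ler_wsqrtr// (bigD1 i)//= lerDl.
by apply: sumr_ge0 => j _; rewrite sqr_ge0.
Qed.

End InnerProduct.

(** * Projection onto a closed convex cone *)

Section ConeProjection.
Context {R : realType} {n : nat}.
Implicit Types (x y p : 'cV[R]_n).

Lemma trmx_continuous m : continuous (fun v : 'rV[R]_m => v^T : 'cV[R]_m).
Proof.
move=> v A /nbhs_ballP[e e0 sub]; apply/nbhs_ballP; exists e => //= w.
move=> [_ vw]; apply: sub; split => // i j; rewrite !mxE; exact: vw.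
Qed.

(** Tychonoff's theorem for row vectors, carried over by transposition. *)
Lemma box_compact x (s : R) :
  compact [set y : 'cV[R]_n | forall i, `|x i 0 - y i 0| <= s].
Proof.
have := @rV_compact _ n (fun i => `[x i 0 - s, x i 0 + s]%classic)
  (fun i => @segment_compact _ _ _).
move=> /(continuous_compact (continuous_subspaceT (@trmx_continuous n))).
congr compact; apply/seteqP; split => [_ [v vs <-] i|y ys] /=.
  by have := vs i; rewrite !mxE /= in_itv/= distrC ler_distl.
exists y^T; last by rewrite trmxK.
by move=> i; have := ys i; rewrite !mxE distrC ler_distl in_itv.
Qed.

Lemma norm2_continuous x : continuous (fun y => norm2 (x - y)).
Proof.
move=> y; apply: (@continuous_comp _ _ _ (fun y => \sum_i (x - y) i 0 ^+ 2) (@Num.sqrt R));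
  last exact: sqrt_continuous.
apply: continuous_big => [|i _]; first exact: add_continuous.
pose f (w : 'cV[R]_n) := x i 0 - w i 0.
rewrite (_ : (fun w => _) = f \* f); last first.
  by apply/funext => w; rewrite !mxE expr2.
have fc : continuous f.
  by move=> z; apply: continuousB; [exact: cst_continuous|exact: coord_continuous].
by move=> z; exact: continuousM (fc z) (fc z).
Qed.

(** It suffices to minimize over the points of C in the box of center x and
    half-width |x|, which contains 0: any point of C outside the box is farther from x than 0 is. *)
Lemma is_projection_ex (C : set 'cV[R]_n) x : closed C -> C 0 ->
  exists p, is_projection C x p.
Proof.
move=> Ccl C0; pose s := norm2 x.
pose B := [set y : 'cV[R]_n | forall i, `|x i 0 - y i 0| <= s].
have B0 : B 0 by move=> i; rewrite mxE subr0 normr_coord_le.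
have CB0 : (B `&` C) !=set0 by exists 0.
have Bsub y : norm2 (x - y) <= s -> B y.
  move=> ys i; apply: le_trans ys.
  by have := normr_coord_le (x - y) i; rewrite !mxE.
have CBc : compact (B `&` C) by apply: compact_closedI => //; exact: box_compact.
have [p] := compact_EVT_min CB0 CBc (continuous_subspaceT (@norm2_continuous x)).
rewrite inE => -[_ Cp] pmin; exists p; split => // y Cy.
have [/Bsub By|/ltW sy] := leP (norm2 (x - y)) s; first by apply: pmin; rewrite inE.
apply: le_trans sy; rewrite /s -[x in leRHS]subr0.
by apply: pmin; rewrite inE.
Qed.

Lemma projectionP (C : set 'cV[R]_n) x : closed C -> C 0 ->
  is_projection C x (projection C x).
Proof. by move=> Ccl C0; have := xgetPex 0 (is_projection_ex x Ccl C0). Qed.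

(** Dividing by t and letting t tend to 0 gives a <= 0; this is how optimality
    along a segment becomes a first-order condition. *)
Lemma first_order_le0 (a b : R) :
  (forall t, 0 < t -> t <= 1 -> t * a <= t ^+ 2 * b) -> a <= 0.
Proof.
move=> H; rewrite leNgt; apply/negP => a0.
have b0 : 0 < b.
  have := H 1 ltr01 (lexx _); rewrite expr1n !mul1r; exact: lt_le_trans.
have ab : a <= b by have := H 1 ltr01 (lexx _); rewrite expr1n !mul1r.
(* At this t the quadratic term is half of the linear one. *)
have t0 : 0 < a / (2 * b) by rewrite divr_gt0// mulr_gt0.
have t1 : a / (2 * b) <= 1 by rewrite ler_pdivrMr ?mulr_gt0//; lra.
have := H _ t0 t1; rewrite expr2 -mulrA ler_pM2l//.
rewrite (_ : a / (2 * b) * b = a / 2); last by field; lra.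
lra.
Qed.

Variable C : set 'cV[R]_n.
Hypothesis C_closed : closed C.
Hypothesis C0 : C 0.
Hypothesis CD : forall y z, C y -> C z -> C (y + z).
Hypothesis CZ : forall (a : R) y, 0 <= a -> C y -> C (a *: y).
Local Notation proj := (projection C).

Lemma projection_in x : C (proj x).
Proof. by have [] := projectionP x C_closed C0. Qed.

(** Expansion of the optimality inequality |x - p|^2 <= |x - (p + t y)|^2. *)
Lemma projection_variation x y (t : R) : C (proj x + t *: y) ->
  2 * t * dot (x - proj x) y <= t ^+ 2 * dot y y.
Proof.
have [_ pmin] := projectionP x C_closed C0.
move=> /pmin; rewrite ler_norm2 !dot_linE.
rewrite (dotC _ x) (dotC y (proj x)) (dotC y x); lra.
Qed.

Lemma projection_polar x y : C y -> dot (x - proj x) y <= 0.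
Proof.
move=> Cy; suff : 2 * dot (x - proj x) y <= 0 by lra.
apply: (@first_order_le0 _ (dot y y)) => t t0 _.
rewrite mulrA (mulrC t); apply: projection_variation.
by apply: CD; [exact: projection_in|apply: CZ => //; exact: ltW].
Qed.

(** Since C is a cone, the projection may be shrunk as well as stretched, so the
    inequality of [projection_polar] at y = p(x) is an equality. *)
Lemma projection_orth x : dot (x - proj x) (proj x) = 0.
Proof.
apply/eqP; rewrite eq_le projection_polar//=; last exact: projection_in.
suff : - (2 * dot (x - proj x) (proj x)) <= 0 by lra.
apply: (@first_order_le0 _ (dot (proj x) (proj x))) => t t0 t1.
rewrite -[t ^+ 2]sqrrN -mulNr mulrA mulrN -mulNr (mulrC _ 2).
apply: projection_variation.
rewrite -[X in X + _]scale1r -scalerDl.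
by apply: CZ; [lra|exact: projection_in].
Qed.

(** With p = p(x) and q = p(x + d), the point p of C is polar to x + d - q, so
    <x + d, p> <= <q, p>; conclude with 0 <= |q - p|^2. *)
Lemma sqnorm_projection_ge x d :
  2 * dot (proj x) d <=
  dot (proj (x + d)) (proj (x + d)) - dot (proj x) (proj x).
Proof.
have := projection_polar (x + d) (projection_in x).
have := projection_orth (x + d); have := projection_orth x.
set p := proj x; set q := proj (x + d).
have := dot_ge0 (q - p); rewrite !dot_linE (dotC _ q) (dotC d p).
lra.
Qed.

(** With p = p(x) and q = p(x + d), the point q of C is polar to x - p, so
    <x, q> <= <p, q>; conclude with 0 <= |x + d - (x - p) - q|^2. *)
Lemma sqnorm_projection_le x d :
  dot (proj (x + d)) (proj (x + d)) - dot (proj x) (proj x) <=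
  2 * dot (proj x) d + dot d d.
Proof.
have := projection_polar x (projection_in (x + d)).
have := projection_orth (x + d); have := projection_orth x.
set p := proj x; set q := proj (x + d).
have := dot_ge0 (d + p - q); rewrite !dot_linE.
rewrite (dotC d p) (dotC q d) (dotC q p).
lra.
Qed.

End ConeProjection.

(** * Functions trapped between an affine function and a quadratic one *)

Section QuadraticallySupported.
Context {R : realType}.

(** The error is an arbitrary quadratic form, rather than a multiple of the
    squared norm, so that affine changes of variable need no operator norm. *)
Definition quad_supported n (f : 'cV[R]_n -> R) : Prop :=
  forall x, exists (v : 'cV[R]_n) (M : 'M[R]_n), forall d,
    dot v d <= f (x + d) - f x <= dot v d + dot d (M *m d).

Lemma quad_supported_add n (f g : 'cV[R]_n -> R) :
  quad_supported f -> quad_supported g -> quad_supported (fun x => f x + g x).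
Proof.
move=> qf qg x; have [v [M fM]] := qf x; have [w [N gN]] := qg x.
exists (v + w), (M + N) => d; have /andP[? ?] := fM d; have /andP[? ?] := gN d.
by rewrite mulmxDl !dot_linE; apply/andP; split; lra.
Qed.

Lemma quad_supported_affine n (c : 'cV[R]_n) k :
  quad_supported (fun x => dot c x + k).
Proof.
move=> x; exists c, 0 => d; rewrite mul0mx -(scale0r d) !dot_linE.
by apply/andP; split; lra.
Qed.

Lemma quad_supported_sum n m (f : 'I_m -> 'cV[R]_n -> R) :
  (forall i, quad_supported (f i)) ->
  quad_supported (fun x => \sum_(i < m) f i x).
Proof.
move=> qf; pose F (r : seq 'I_m) x := \sum_(i <- r) f i x.
rewrite -/(F _); elim: (index_enum _) => [|i r IHr].
  rewrite (_ : F [::] = fun x => dot 0 x + 0); first exact: quad_supported_affine.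
  by apply/funext => x; rewrite /F big_nil addr0 /dot trmx0 mul0mx mxE.
rewrite (_ : F _ = fun x => f i x + F r x); first exact: quad_supported_add.
by apply/funext => x; rewrite /F big_cons.
Qed.

Lemma quad_supported_scale n (a : R) (f : 'cV[R]_n -> R) : 0 <= a ->
  quad_supported f -> quad_supported (fun x => a * f x).
Proof.
move=> a0 qf x; have [v [M fM]] := qf x; exists (a *: v), (a *: M) => d.
have /andP[lo hi] := fM d.
by rewrite -scalemxAl !dot_linE -mulrBr -mulrDr !ler_wpM2l.
Qed.

Lemma quad_supported_comp n p (f : 'cV[R]_p -> R) (A : 'M[R]_(p, n)) c :
  quad_supported f -> quad_supported (fun x => f (A *m x + c)).
Proof.
move=> qf x; have [v [M fM]] := qf (A *m x + c).
exists (A^T *m v), (A^T *m M *m A) => d.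
have := fM (A *m d).
by rewrite mulmxDr addrAC -!dot_mulmxr -!mulmxA [dot d _]dot_mulmxr trmxK.
Qed.

(** The gradient at x is P x + P^T x, and the remainder is exactly the form
    evaluated at the displacement. *)
Lemma quad_supported_form n (P : 'M[R]_n) : (forall u, 0 <= dot u (P *m u)) ->
  quad_supported (fun x => dot x (P *m x)).
Proof.
move=> P0 x; exists (P *m x + P^T *m x), P => d; have := P0 d.
rewrite mulmxDr !dot_linE -dot_mulmxr (dotC (P *m x)).
by move=> ?; apply/andP; split; lra.
Qed.

(** The affine minorant at the intermediate point bounds f from below at both
    endpoints, and its linear parts cancel in the convex combination. *)
Lemma quad_supported_convex n (f : 'cV[R]_n -> R) (t : R) x y :
  quad_supported f -> 0 <= t <= 1 ->
  f (t *: x + (1 - t) *: y) <= t * f x + (1 - t) * f y.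
Proof.
move=> qf /andP[t0 t1]; pose z := t *: x + (1 - t) *: y; rewrite -/z.
have [v [M fz]] := qf z.
have /andP[fx _] := fz ((1 - t) *: (x - y)).
have /andP[fy _] := fz ((- t) *: (x - y)).
have xE : z + (1 - t) *: (x - y) = x.
  by apply/colP => i; rewrite /z !mxE; ring.
have yE : z + (- t) *: (x - y) = y.
  by apply/colP => i; rewrite /z !mxE; ring.
rewrite xE dotZr -/z in fx; rewrite yE dotZr -/z in fy.
have := ler_wpM2l t0 fx; have : 0 <= 1 - t by lra.
move=> /ler_wpM2l/(_ _ _ fy); lra.
Qed.

Lemma normr_coord_le_norm n (d : 'cV[R]_n) i : `|d i 0| <= `|d|.
Proof.
have := lexx `|d|; rewrite {1}/Num.Def.normr/= mx_normrE => /bigmax_leP[_].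
by move=> /(_ (i, 0) isT).
Qed.

Lemma quad_form_le n (M : 'M[R]_n) :
  exists2 K : R, 0 <= K & forall d, dot d (M *m d) <= K * `|d| ^+ 2.
Proof.
exists (\sum_i \sum_j `|M i j|); first by do 2 apply: sumr_ge0 => ? _.
move=> d; rewrite dotE mulr_suml ler_sum// => i _.
rewrite mxE mulr_sumr mulr_suml ler_sum// => j _.
rewrite (le_trans (ler_norm _))// !normrM mulrCA ler_wpM2l// expr2.
by rewrite ler_pM// normr_coord_le_norm.
Qed.

Lemma dot_differentiable n (v x : 'cV[R]_n) : differentiable (dot v) x.
Proof.
rewrite (_ : dot v = \sum_i v i 0 *: (fun w : 'cV[R]_n => w i 0)).
  apply: differentiable_sum => i; apply: differentiableZ.
  exact: differentiable_coord.
by apply/funext => w; rewrite dotE fct_sumE.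
Qed.

(** Such a function has derivative 0 at x. *)
Lemma differentiable_quad_bound (V W : normedModType R) (r : V -> W) x (K : R) :
  0 <= K ->
  (forall d, `|r (x + d) - r x| <= K * `|d| ^+ 2) -> differentiable r x.
Proof.
move=> K0 rK.
pose L : {linear V -> W} := \0.
have L0 : continuous L by exact: cst_continuous.
have rE : r \o shift x = cst (r x) + L +o_ 0 id.
  apply/eqaddoP => e e0; near=> d.
  rewrite /= !fctE/= addr0 [d + x]addrC (le_trans (rK _))//.
  rewrite expr2 mulrA ler_wpM2r//.
  near: d; apply/nbhs_normP; exists (e / (K + 1)).
    by rewrite /= divr_gt0// ltr_wpDl.
  move=> d /=; rewrite sub0r normrN ltr_pdivlMr ?ltr_wpDl// => de.
  by rewrite (le_trans _ (ltW de))// mulrC ler_wpM2l// lerDl.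
by apply/diff_locallyP; rewrite (diff_unique L0 rE).
Unshelve. all: by end_near. Qed.

(** Subtracting the linear part at x leaves a function whose increments at x
    are bounded by a quadratic form, hence of zero derivative there. *)
Lemma quad_supported_differentiable n (f : 'cV[R]_n -> R) x :
  quad_supported f -> differentiable f x.
Proof.
move=> qf; have [v [M fM]] := qf x; have [K K0 MK] := quad_form_le M.
rewrite (_ : f = (f \- dot v) + dot v); last first.
  by apply/funext => y /=; rewrite !fctE /= subrK.
apply: differentiableD; last exact: dot_differentiable.
apply: (differentiable_quad_bound K0) => d; have /andP[lo hi] := fM d.
rewrite /= dotDr [X in `|X|](_ : _ = f (x + d) - f x - dot v d); last by ring.
rewrite ger0_norm ?subr_ge0//; apply: le_trans (MK d); lra.
Qed.

End QuadraticallySupported.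

(** * The positive semidefinite cone in vectorized form *)

Section PsdCone.
Context {R : realType} {h : nat}.
Implicit Types z w : 'cV[R]_(svec_dim h).

Lemma psd_coneP z : psd_cone z <-> forall v, 0 <= dot v (smat z *m v).
Proof.
split => [[_ zv] v|zv]; first by rewrite /dot mulmxA.
by split => [|v]; [exact: smat_sym|rewrite -mulmxA; exact: zv].
Qed.

Lemma smatD z w : smat (z + w) = smat z + smat w.
Proof. by apply/matrixP => i j; rewrite !mxE; case: ifP; rewrite ?mulrDl. Qed.

Lemma smatZ a z : smat (a *: z) = a *: smat z.
Proof. by apply/matrixP => i j; rewrite !mxE; case: ifP; rewrite ?mulrA. Qed.

Lemma psd_coneD z w : psd_cone z -> psd_cone w -> psd_cone (z + w).
Proof.
move=> /psd_coneP z0 /psd_coneP w0; apply/psd_coneP => v.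
by rewrite smatD mulmxDl dotDr addr_ge0.
Qed.

Lemma psd_coneZ a z : 0 <= a -> psd_cone z -> psd_cone (a *: z).
Proof.
move=> a0 /psd_coneP z0; apply/psd_coneP => v.
by rewrite smatZ -scalemxAl dotZr mulr_ge0.
Qed.

Lemma psd_cone0 : psd_cone (0 : 'cV[R]_(svec_dim h)).
Proof.
apply/psd_coneP => v; rewrite -(scale0r (0 : 'cV_(svec_dim h))) smatZ scale0r mul0mx.
by rewrite /dot mulmx0 mxE.
Qed.

(** As a function of z this is a linear combination of coordinates, the
    off-diagonal ones carrying the factor 1 / sqrt 2 of [smat]. *)
Lemma smat_form_continuous v : continuous (fun z => dot v (smat z *m v)).
Proof.
pose c i j : R := v i 0 * v j 0 * (if i == j then 1 else (Num.sqrt 2)^-1).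
rewrite (_ : (fun z => _) = \sum_i \sum_j
    c i j *: (fun z : 'cV[R]_(svec_dim h) => z (svec_idx i j) 0)).
  move=> z; apply: differentiable_continuous.
  do 2 apply: differentiable_sum => ?.
  by apply: differentiableZ; exact: differentiable_coord.
apply/funext => z; rewrite dotE fct_sumE; apply: eq_bigr => i _.
rewrite fct_sumE mxE mulr_sumr; apply: eq_bigr => j _.
rewrite !mxE /c !fctE /GRing.scale/=; case: ifP => _; ring.
Qed.

Lemma psd_cone_closed : closed (@psd_cone R h).
Proof.
rewrite (_ : @psd_cone R h = \bigcap_(v in setT)
    (fun z => dot v (smat z *m v)) @^-1` [set r | 0 <= r]).
  apply: closed_bigI => v _; apply: closed_comp; last exact: closed_ge.
  by move=> z _; exact: smat_form_continuous.
by apply/seteqP; split=> [z /psd_coneP zv v _|z zv]; [exact: zv|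
  apply/psd_coneP => v; exact: zv].
Qed.

Lemma quad_supported_sqnorm_proj_psd :
  quad_supported (fun z => norm2 (@proj_psd R h z) ^+ 2).
Proof.
move=> x; exists (2 *: proj_psd x), 1%:M => d.
rewrite !norm2_sqr mul1mx dotZl; apply/andP; split.
  by apply: sqnorm_projection_ge; [exact: psd_cone_closed|exact: psd_cone0|
    exact: psd_coneD|exact: psd_coneZ].
by apply: sqnorm_projection_le; [exact: psd_cone_closed|exact: psd_cone0|
  exact: psd_coneD|exact: psd_coneZ].
Qed.

End PsdCone.

(** * The dual function *)

(** The form of the inverse of Q at z = Q u is the form of Q at u. *)
Lemma invmx_form_ge0 (R : realType) n (Q : 'M[R]_n) (z : 'cV[R]_n) :
  posdefmx Q -> 0 <= dot z (invmx Q *m z).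
Proof.
move=> [_ Qpos].
have Qunit : Q \in unitmx.
  rewrite -row_free_unit; apply: inj_row_free => v vQ.
  apply/eqP/negPn/negP => v0; have := Qpos v^T; rewrite trmx_eq0 => /(_ v0).
  by rewrite trmxK vQ mul0mx mxE ltxx.
rewrite -{1}(mulKVmx Qunit z) dot_mulmxl dotC -dot_mulmxr.
have [->|u0] := eqVneq (invmx Q *m z) 0; first by rewrite /dot !mulmx0 mxE.
by apply: ltW; have := Qpos _ u0; rewrite /dot mulmxA.
Qed.

Lemma quad_supported_opp_dual_fun (R : realType) (m nf msos : nat)
    (h : 'I_msos -> nat)
    (Af : 'M[R]_(m, nf)) (wf : 'cV[R]_nf) (b : 'cV[R]_m)
    (Asos : forall j : 'I_msos, 'M[R]_(m, svec_dim (h j)))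
    (wsos : forall j : 'I_msos, 'cV[R]_(svec_dim (h j)))
    (rho : R) (Q : 'M[R]_nf) :
  0 < rho -> posdefmx Q ->
  quad_supported (fun x => - dual_fun Af wf b Asos wsos rho Q x).
Proof.
move=> rho0 Qpos; set P := invmx Q.
(* The summand 0 gives the argument the shape A x + c of [quad_supported_comp]. *)
pose quad x := 2^-1 * dot (Af^T *m x + 0) (P *m (Af^T *m x + 0)).
pose aff x := dot (- (Af *m P *m wf + b)) x + 2^-1 * (wf^T *m P *m wf) 0 0.
pose pen x := rho / 2 * \sum_(j < msos)
  norm2 (proj_psd (rho^-1 *: (Asos j)^T *m x + - (rho^-1 *: wsos j))) ^+ 2.
rewrite (_ : (fun x => _) = fun x => quad x + aff x + pen x); last first.
  apply/funext => x.
  have -> : pen x = rho / 2 * \sum_(j < msos)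
      norm2 (proj_psd (rho^-1 *: ((Asos j)^T *m x - wsos j))) ^+ 2.
    by congr (_ * _); apply: eq_bigr => j _; rewrite scalerBr scalemxAl.
  rewrite /dual_fun /quad /aff addr0.
  have -> : (x^T *m Af *m P *m Af^T *m x) 0 0 =
      dot (Af^T *m x) (P *m (Af^T *m x)).
    by rewrite /dot trmx_mul trmxK !mulmxA.
  rewrite dotNl (dotC _ x) /dot; ring.
have half0 : 0 <= 2^-1 :> R by rewrite invr_ge0.
apply: quad_supported_add; first apply: quad_supported_add.
- apply: quad_supported_scale => //.
  apply: (@quad_supported_comp _ _ _ (fun z => dot z (P *m z))).
  by apply: quad_supported_form => u; exact: invmx_form_ge0.
- exact: quad_supported_affine.
apply: quad_supported_scale; first by rewrite divr_ge0// ltW.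
apply: quad_supported_sum => j.
apply: (@quad_supported_comp _ _ _ (fun z => norm2 (proj_psd z) ^+ 2)).
exact: quad_supported_sqnorm_proj_psd.
Qed.

Theorem lemma3p5 (R : realType) (m nf msos : nat) (h : 'I_msos -> nat)
    (Af : 'M[R]_(m, nf)) (wf : 'cV[R]_nf) (b : 'cV[R]_m)
    (Asos : forall j : 'I_msos, 'M[R]_(m, svec_dim (h j)))
    (wsos : forall j : 'I_msos, 'cV[R]_(svec_dim (h j)))
    (rho : R) (Q : 'M[R]_nf) :
  (0 < m)%N -> (0 < nf)%N -> (0 < msos)%N -> (forall j, (0 < h j)%N) ->
  0 < rho ->
  posdefmx Q ->
  concave_function setT (dual_fun Af wf b Asos wsos rho Q) /\
  (forall lambda : 'cV[R]_m,
     differentiable (dual_fun Af wf b Asos wsos rho Q) lambda).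
Proof.
move=> _ _ _ _ rho0 Qpos.
have qs := quad_supported_opp_dual_fun Af wf b Asos wsos rho0 Qpos.
split => [t x y _ _|x].
  rewrite convRE.
  have t01 : 0 <= t%:num <= 1 by rewrite ge0 le1.
  have := quad_supported_convex x y qs t01.
  by rewrite !mulrN -opprD lerN2.
rewrite -[dual_fun _ _ _ _ _ _ _]opprK.
exact: differentiableN (quad_supported_differentiable x qs).
Qed.
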